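(* Let $\alpha\in(0,1)$. Suppose that the measure center of the dynamical system $(X,f)$ is $X$. If $(X,f)$ has the $\mathscr{M}_{\alpha}$-shadowing property, then $(X,f)$ is weakly mixing.
   Context: $\mathbb{N}=\{1,2,3,\ldots\}$ and $\mathbb{N}_0=\{0,1,2,\ldots\}$. A dynamical system is a pair $(X,f)$ where $(X,d)$ is a compact metric space and $f\colon X\to X$ is a continuous surjection. Transitivity notions: for $A,B\subseteq X$, $N_f(A,B)=\{n\in\mathbb{N}: f^n(A)\cap B\neq\varnothing\}$. $(X,f)$ is transitive if $N_f(U,V)\neq\varnothing$ for all nonempty open $U,V\subseteq X$; it is weakly mixing if $(X\times X,f\times f)$ is transitive. $\mathcal{M}(X,f)$ is the set of $f$-invariant Borel probability measures on $X$; $\operatorname{supp}(\mu)$ is the set of $x\in X$ with $\mu(U)>0$ for every open neighborhood $U$ of $x$. The measure center of $(X,f)$ is $\mathrm{supp}(X,f)=\overline{\bigcup_{\mu\in\mathcal{M}(X,f)}\operatorname{supp}(\mu)}$. Density and shadowing: for $A\subseteq\mathbb{N}_0$, $\underline{\mathrm{Dens}}(A)=\liminf_{n\to\infty}\frac{\#(A\cap\{0,\ldots,n\})}{n+1}$. For $\alpha\in[0,1)$, $\mathscr{M}_\alpha$ is the family of all $A\subseteq\mathbb{N}_0$ with $\underline{\mathrm{Dens}}(A)>\alpha$. For $\delta>0$, a sequence $\{x_i\}_{i=0}^\infty\subseteq X$ is a $\delta$-ergodic pseudo-orbit if $\lim_{n\to\infty}\frac{1}{n}\#\{0\le i<n: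 d(f(x_i),x_{i+1})\ge\delta\}=0$. $(X,f)$ has the $\mathscr{M}_\alpha$-shadowing property if for every $\varepsilon>0$ there is $\delta>0$ such that for every $\delta$-ergodic pseudo-orbit $\{x_i\}_{i=0}^\infty$ there is $z\in X$ with $\{j\in\mathbb{N}_0: d(f^j(z),x_j)<\varepsilon\}\in\mathscr{M}_\alpha$. *)

(* Defs.v *)
From HB Require Import structures.
From mathcomp Require Import all_boot all_order all_algebra.
From mathcomp Require Import all_classical all_reals all_analysis.

Set Implicit Arguments.
Unset Strict Implicit.
Unset Printing Implicit Defensive.

Import Order.TTheory GRing.Theory Num.Theory.
Import numFieldNormedType.Exports.

Local Open Scope classical_set_scope.
Local Open Scope ring_scope.

(* [measurableType], hence the type of probability measures, requires a pointed
   carrier, which [metricType] does not provide. *)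
#[short(type="pointedMetricType")]
HB.structure Definition PointedMetric (R : numDomainType) :=
  { M of Pointed M & Metric R M }.

Section transitivity.

(* Hitting times are positive integers: [n = 0] is excluded. *)
Definition hitting_times (T : Type) (f : T -> T) (A B : set T) : set nat :=
  [set n | (0 < n)%N /\ (iter n f @` A) `&` B !=set0].

Definition transitive_map (T : topologicalType) (f : T -> T) : Prop :=
  forall U V : set T, open U -> open V -> U !=set0 -> V !=set0 ->
    hitting_times f U V !=set0.

Definition prod_map (T : Type) (f : T -> T) (p : T * T) : T * T :=
  (f p.1, f p.2).

Definition weakly_mixing (T : topologicalType) (f : T -> T) : Prop :=
  transitive_map (prod_map f).

End transitivity.

Section measure_center.
Variables (R : realType) (X : pointedMetricType R).

Local Notation borel := (g_sigma_algebraType (@open X)).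

Definition invariant_measures (f : X -> X) : set (probability borel R) :=
  [set mu | forall A : set borel, measurable A -> mu (f @^-1` A) = mu A].

Definition measure_support (mu : probability borel R) : set X :=
  [set x | forall U : set X, open_nbhs x U -> (0 < mu U)%E].

Definition measure_center (f : X -> X) : set X :=
  closure (\bigcup_(mu in invariant_measures f) measure_support mu).

End measure_center.

Section density.
Variable R : realType.

Definition count_below (A : set nat) (n : nat) : nat :=
  #|[pred i : 'I_n | (i : nat) \in A]|.

Definition lower_density (A : set nat) : R :=
  limn_inf (fun n => (count_below A n.+1)%:R / n.+1%:R : R).

Definition density_family (alpha : R) : set (set nat) :=
  [set A | alpha < lower_density A].

End density.

Section shadowing.
Variables (R : realType) (X : metricType R).

Definition dynamical_system (f : X -> X) : Prop :=
  [/\ compact [set: X], continuous f & set_surj [set: X] [set: X] f].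

Definition ergodic_pseudo_orbit (f : X -> X) (delta : R) (x : nat -> X) : Prop :=
  ((count_below [set i | delta <= mdist (f (x i)) (x i.+1)] n)%:R / n%:R : R)
    @[n --> \oo] --> (0 : R).

Definition density_shadowing (alpha : R) (f : X -> X) : Prop :=
  forall eps : R, 0 < eps ->
    exists2 delta : R, 0 < delta &
      forall x : nat -> X, ergodic_pseudo_orbit f delta x ->
        exists z : X,
          density_family alpha [set j | mdist (iter j f z) (x j) < eps].

End shadowing.

(* Main.v *)
Require Import Defs.
From HB Require Import structures.
From mathcomp Require Import all_boot all_order all_algebra.
From mathcomp Require Import all_classical all_reals all_analysis.
From mathcomp Require Import measurable_realfun lra zify.
Import Order.TTheory GRing.Theory Num.Theory.
Import numFieldNormedType.Exports.
Local Open Scope classical_set_scope.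
Local Open Scope ring_scope.

(** The heart of the matter is that for nonempty open [U], [W], [V] the sets
    of hitting times $N(U,V)$ and $N(W,V)$ have a common element
    ([common_hitting_time]). Weak mixing follows: given $U_1, V_1, U_2, V_2$,
    choose $n$ with $V' = V_1 \cap f^{-n}(V_2)$ nonempty; a common element
    $k$ of $N(U_1, V')$ and $N(f^{-n}(U_2), V')$ belongs to $N(U_1,V_1)$ and
    to $N(U_2,V_2)$, and $f^{-n}(U_2)$ is nonempty because [f] is onto.

    To find a common hitting time, one shadows a pseudo-orbit made of orbit
    segments on the blocks $[M^p, M^{p+1})$, where $M > 2/\alpha$. The jumps
    between blocks have density zero, and the blocks grow so fast that a
    shadowing set of lower density greater than $\alpha$ fills more than the
    proportion $\alpha/2$ of every late block ([shadow_blocks]). Since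
    $\alpha$ may be small, the shadowing times might all avoid the visits of
    the segment to its target. Two facts exclude this. First, shadowing at a
    time persists, up to a worse precision, for any fixed number $L$ of later
    steps, so it suffices to shadow at a time after which the target is
    visited within $L$ steps. Second, for an invariant measure $\mu$
    the set of points whose orbit ever visits [V] equals
    $f^{-i}$(points visiting [V] within $L$ steps) up to small measure, for
    every $i$ and one large $L$; integrating over a set [W] of such points
    gives a point of [W] for which a proportion at least $1-\alpha/2$ of the
    times of any prescribed window is followed by a visit within $L$ steps
    ([frequent_visits]). As the measure center is [X], every nonempty open [W]
    is charged by some invariant measure.

    Blocks come in countably many types, each used infinitely often. On blocks
    of type $0$ the segment frequently visits [U], so the shadowing point $z$
    is in [U] at some time $a$. On blocks of type $a+1$ the segment is that of
    a point $y \in W$ started at time $a$, and frequently visits [V]. On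
    a late block of that type, $z$ and the orbit of $y$ started at time $a$ are
    simultaneously in [V], say at time $b$; then $b-a$ is the common hitting
    time. Having a type for every $a$ resolves the circularity that $a$ depends
    on $z$, hence on the whole pseudo-orbit. *)

(** * Counting and lower density *)

Lemma count_belowE (A : set nat) (n : nat) :
  count_below A n = (\sum_(0 <= i < n) (i \in A))%N.
Proof.
rewrite /count_below -sum1_card big_mkord [RHS]big_mkcond/= big_mkcond/=.
by apply: eq_bigr => i _; rewrite inE; case: ifP.
Qed.

Lemma count_below_le (A : set nat) (n : nat) : (count_below A n <= n)%N.
Proof. by rewrite -[leqRHS]card_ord max_card. Qed.

Lemma count_below_split (A : set nat) (a b : nat) : (a <= b)%N ->
  count_below A b =
  (count_below A a + count_below [set i | A (a + i)%N] (b - a))%N.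
Proof.
move=> ab; rewrite !count_belowE (@big_cat_nat _ _ _ a)//=; congr addn.
rewrite -{1}[a]add0n big_addn; apply: eq_bigr => i _.
by rewrite addnC; congr nat_of_bool; apply/idP/idP => /set_mem ?; apply/mem_set.
Qed.

Lemma count_below_meet (A B : set nat) (n : nat) :
  (n < count_below A n + count_below B n)%N ->
  exists2 i, (i < n)%N & A i /\ B i.
Proof.
move=> nAB; apply: contrapT => nmeet; move: nAB; apply/negP; rewrite -leqNgt.
rewrite !count_belowE -big_split/= -[leqRHS]subn0 -[leqRHS]muln1.
rewrite -sum_nat_const_nat.
rewrite !big_nat; apply: leq_sum => i /= iltn.
case: (boolP (i \in A)) => [/set_mem iA|_]; last by case: (_ \in _).
case: (boolP (i \in B)) => // /set_mem iB.
by case: nmeet; exists i.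
Qed.

Lemma lt_lower_density {R : realType} {A : set nat} {alpha : R} :
  alpha < lower_density R A ->
  exists N, forall n, (N < n)%N -> alpha * n%:R < (count_below A n)%:R.
Proof.
rewrite /lower_density.
set u := (fun n => _).
have u0 n : 0 <= u n by rewrite /u divr_ge0.
have u1 n : u n <= 1.
  by rewrite /u ler_pdivrMr ?ltr0Sn// mul1r ler_nat count_below_le.
have lbu : has_lbound (range u) by exists 0 => _ [n _ <-].
rewrite limn_infE; last first.
  exists 1; split; first by rewrite num_real.
  by move=> M M1 n _ /=; rewrite ger0_norm ?u0// (le_trans (u1 n))// ltW.
move=> /sup_gt[|_ [N _ <-] aN].
  by exists (infs u 0), 0%N.
exists N => -[//|n] Nn.
rewrite -ltr_pdivlMr ?ltr0Sn//; apply: (lt_le_trans aN).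
apply: inf_lbound; first exact: has_lbound_sdrop.
by exists n.
Qed.

(** Bounding the square of a logarithm by a linear function is enough to make
    logarithmic counts negligible, and avoids real powers. *)
Lemma sqr_le_4expn n : (n.+2 ^ 2 <= 4 * 2 ^ n.+1)%N.
Proof.
elim: n => [//|[|n] ih] //.
rewrite expnS mulnCA; apply: (@leq_trans (2 * n.+3 ^ 2)%N); last first.
  by rewrite leq_mul2l.
nia.
Qed.

Lemma count_powers (M n : nat) : (1 < M)%N ->
  (count_below [set j | exists p, j.+1 = (M ^ p)%N] n <= (trunc_log M n).+1)%N.
Proof.
move=> M1; set A := [set _ | _].
have -> : count_below A n = size [seq i <- iota 0 n | i \in A].
  rewrite size_filter -sum1_count big_mkcond/= count_belowE /index_iota subn0.
  by apply: eq_bigr => i _; case: (_ \in _).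
rewrite -[leqRHS](size_iota 0) -[leqRHS](size_map (fun p => (M ^ p).-1)%N).
apply: uniq_leq_size; first by rewrite filter_uniq ?iota_uniq.
move=> j; rewrite mem_filter mem_iota add0n => /andP[/set_mem[p jp] /= jn].
apply/(@mapP _ _ (fun p => (M ^ p).-1)%N (iota 0 (trunc_log M n).+1)).
exists p; last by rewrite -jp.
by rewrite mem_iota add0n /= ltnS; apply: trunc_log_max; rewrite // -jp.
Qed.

Lemma count_powers_cvg {R : realType} (M : nat) (A : set nat) : (1 < M)%N ->
  A `<=` [set j | exists p, j.+1 = (M ^ p)%N] ->
  ((count_below A n)%:R / n%:R : R) @[n --> \oo] --> (0 : R).
Proof.
move=> M1 AP; apply/cvgrPdist_lt => e e0.
have [N Ne] : exists N : nat, 8 / e ^+ 2 < N%:R.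
  by exists (Num.truncn (8 / e ^+ 2)).+1; apply: truncnS_gt.
exists N.+1 => // n /= Nn.
have n0 : (0 < n)%N by case: n Nn.
rewrite sub0r normrN ger0_norm ?divr_ge0// ltr_pdivrMr ?ltr0n//.
rewrite ltNge; apply/negP => le_c.
set c := count_below A n in le_c.
have cn : (c ^ 2 <= 8 * n)%N.
  have /leq_trans : (c <= (trunc_log M n).+2)%N.
    apply: leq_trans (leq_trans (count_powers _ _ M1) (leqnSn _)).
    rewrite /c !count_belowE; apply: leq_sum => i _.
    case: (boolP (i \in A)) => // /set_mem/AP iA.
    by rewrite (mem_set iA).
  move=> /(_ _ (leqnn _)); rewrite -(leq_exp2r _ _ (isT : (0 < 2)%N)).
  move=> /leq_trans; apply; apply: leq_trans (sqr_le_4expn _) _.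
  rewrite expnS mulnA leq_mul2l/= (leq_trans _ (trunc_logP M1 n0))//.
  by case: (trunc_log M n) => // t; rewrite leq_exp2r.
have : (c%:R ^+ 2 : R) <= 8 * n%:R by rewrite -natrX -natrM ler_nat.
have ne : 8 < e ^+ 2 * n%:R.
  rewrite mulrC -ltr_pdivrMr ?exprn_gt0// (lt_trans Ne)// ltr_nat.
  exact: leq_trans Nn.
have : (e * n%:R) ^+ 2 <= c%:R ^+ 2.
  by rewrite ler_pXn2r// nnegrE// mulr_ge0// ltW.
move=> /le_trans/[apply].
rewrite [(e * _) ^+ 2]exprMn [n%:R ^+ 2]expr2 mulrA.
rewrite ler_pM2r ?ltr0n// => /(lt_le_trans ne).
by rewrite ltxx.
Qed.

(** * Shadowing orbit segments on geometrically growing blocks *)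

Lemma continuous_iter {T : topologicalType} (f : T -> T) k :
  continuous f -> continuous (iter k f).
Proof.
move=> cf; elim: k => [|k ih] x; first exact: cvg_id.
by apply: continuous_comp; [exact: ih|exact: cf].
Qed.

Lemma near0_equicontinuous {R : realType} {X : metricType R} (g : X -> X)
    (e : R) : compact [set: X] -> continuous g -> 0 < e ->
  \forall d \near 0^'+, forall x y, mdist x y < d -> mdist (g x) (g y) < e.
Proof.
move=> /compact_near_coveringP cX cg e0.
suff : \forall d \near 0^'+, [set: X] `<=`
    [set x | forall y, mdist x y < d -> mdist (g x) (g y) < e].
  by apply: filterS => d dP x; exact: dP.
apply: cX => x _.
have e20 : 0 < e / 2 by rewrite divr_gt0.
have /nbhs_ballP[r /= r0 gr] := cg x _ (nbhsx_ballx (g x) _ e20).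
have r20 : 0 < r / 2 by rewrite divr_gt0.
have gE y : mdist x y < r -> mdist (g x) (g y) < e / 2.
  by move=> xy; have := gr y; rewrite !ballEmdist; apply.
exists (ball x (r / 2), [set d | d < r / 2]) => /=.
  by split; [exact: nbhsx_ballx|exact: nbhs_right_lt].
move=> [x' d]/= [+ dr] y x'y; rewrite ballEmdist/= => xx'.
rewrite (le_lt_trans (metric_triangle _ (g x) _))// (splitr e) ltrD//.
  by rewrite metric_sym gE// (lt_trans xx')// ltr_pdivrMr// ltr_pMr// ltr1n.
rewrite gE// (le_lt_trans (metric_triangle _ x' _))// (splitr r) ltrD//.
exact: lt_trans dr.
Qed.

Lemma iter_equicontinuous {R : realType} {X : metricType R} (f : X -> X)
    (e : R) (L : nat) : compact [set: X] -> continuous f -> 0 < e ->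
  exists2 d, 0 < d & forall k, (k <= L)%N ->
    forall x y, mdist x y < d -> mdist (iter k f x) (iter k f y) < e.
Proof.
move=> cX cf e0.
have cfk k := continuous_iter f k cf.
suff : \forall d \near 0^'+, forall k, (k <= L)%N ->
    forall x y, mdist x y < d -> mdist (iter k f x) (iter k f y) < e.
  by move=> /(filterI (nbhs_right_gt 0))/filter_ex[d [d0 dP]]; exists d.
elim: L => [|L ih].
  have := near0_equicontinuous (iter 0 f) e cX (cfk 0%N) e0.
  by apply: filterS => d dP k; rewrite leqn0 => /eqP ->.
have := near0_equicontinuous (iter L.+1 f) e cX (cfk L.+1) e0.
apply: filterS2 ih => d dL dS k; rewrite leq_eqVlt => /orP[/eqP ->//|].
exact: dL.
Qed.

(** On the block $[M^p, M^{p+1})$, where [trunc_log M j = p], the sequence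
    follows the orbit of [w p]; it can only jump just before a power of [M].
    The convention [trunc_log M 0 = 0] attaches the time [0] to the first
    block. *)
Lemma block_pseudo_orbit {R : realType} {X : metricType R} (f : X -> X)
    (M : nat) (w : nat -> X) (delta : R) : (1 < M)%N -> 0 < delta ->
  ergodic_pseudo_orbit f delta (fun j =>
    iter (j - M ^ trunc_log M j) f (w (trunc_log M j))).
Proof.
move=> M1 d0; apply: (count_powers_cvg _ _ M1) => j /=.
apply: contraPP => nj; apply/negP; rewrite -ltNge.
have lej := trunc_logP M1 (ltn0Sn j).
have ltj := trunc_log_ltn j.+1 M1.
set p := trunc_log M j.+1 in lej ltj *.
have lepj : (M ^ p <= j)%N.
  by move: lej; rewrite leq_eqVlt => /orP[/eqP pj|//]; case: nj; exists p.
have -> : trunc_log M j = p by apply: trunc_log_eq => //; rewrite lepj ltnW.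
by rewrite subSn// iterS mdistxx.
Qed.

(** In each block more than the proportion [alpha / 2] of the times is
    shadowed, because all the earlier blocks together have only the proportion
    [1 / M < alpha / 2] of the times up to the end of the block. So some
    shadowed time is followed by a visit to the target [T p] within [L] steps,
    and by equicontinuity shadowing persists until that visit. *)
Lemma shadow_blocks {R : realType} {X : metricType R} (f : X -> X)
    (alpha e : R) (L M : nat) (T : nat -> set X) (w : nat -> X) :
  compact [set: X] -> continuous f -> density_shadowing alpha f ->
  0 < alpha < 1 -> 0 < e -> 2 < alpha * M%:R ->
  (forall p, (1 - alpha / 2) * (M ^ p.+1 - M ^ p)%:R <=
    (count_below [set i | exists2 k, (k <= L)%N & T p (iter (i + k) f (w p))]
       (M ^ p.+1 - M ^ p))%:R) ->
  exists z p0, forall p, (p0 <= p)%N -> exists m,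
    T p (iter m f (w p)) /\ mdist (iter m f (w p)) (iter (M ^ p + m) f z) < e.
Proof.
move=> cX cf shf /andP[a0 a1] e0 aM goodT.
have M2 : (2 < M)%N.
  rewrite -(ltr_nat R) (lt_le_trans aM)// ler_piMl// ltW//.
have M1 : (1 < M)%N by rewrite ltnW.
have [d d0 dP] := iter_equicontinuous f e L cX cf e0.
have [delta delta0 /(_ _ (block_pseudo_orbit f M w delta M1 delta0))[z]]
  := shf d d0.
pose x j := iter (j - M ^ trunc_log M j) f (w (trunc_log M j)).
rewrite -/x; set A := [set j | _].
move=> /lt_lower_density[N traced].
exists z, N => p Np.
pose B := [set i | exists2 k, (k <= L)%N & T p (iter (i + k) f (w p))].
have ltMp q : (q < M ^ q)%N by rewrite ltn_expl.
have leMp : (M ^ p <= M ^ p.+1)%N by rewrite leq_exp2l.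
have xE i : (i < M ^ p.+1 - M ^ p)%N -> x (M ^ p + i)%N = iter i f (w p).
  move=> ilt; rewrite /x (trunc_log_eq (n := p))//; first by rewrite addKn.
  by rewrite leq_addr /= -ltn_subRL.
have [|i ilt [iA [k kL Tk]]] := @count_below_meet
    [set i | A (M ^ p + i)%N] B (M ^ p.+1 - M ^ p).
  (* Shadowed times before the block number at most [M ^ p]. *)
  have := traced (M ^ p.+1)%N (leq_ltn_trans Np (ltnW (ltMp p.+1))).
  rewrite (count_below_split _ _ _ leMp) natrD -(ltr_nat R) natrD => tr.
  have := goodT p; rewrite -/B => gd.
  have := count_below_le A (M ^ p); rewrite -(ler_nat R) => le1.
  rewrite (natrB _ leMp) in gd *.
  have Mp0 : (0 : R) < (M ^ p)%:R by rewrite ltr0n expn_gt0 ltnW.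
  have : 0 < (alpha * M%:R - 2) * (M ^ p)%:R by rewrite mulr_gt0// subr_gt0.
  move: tr gd; rewrite [(M ^ p.+1)%N]expnS natrM.
  set c1 := (count_below A _)%:R in le1 *.
  set m := (M ^ p)%:R in le1 Mp0 *.
  set c2 := _%:R; set c3 := _%:R => tr gd pos.
  nra.
exists (i + k)%N; split=> //.
rewrite addnA ![(_ + k)%N]addnC 2!(iterD k); apply: dP => //.
by rewrite metric_sym -xE.
Qed.

(** * Points with frequent visits *)

Section visits.
Context {R : realType} {X : pointedMetricType R}.
Local Notation borel := (g_sigma_algebraType (@open X)).

Definition visits_within (f : X -> X) (L : nat) (V : set X) : set X :=
  [set x | exists2 k, (k <= L)%N & V (iter k f x)].

Lemma open_iter_preimage (f : X -> X) k (U : set X) :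
  continuous f -> open U -> open (iter k f @^-1` U).
Proof. by move=> cf; apply: open_comp => x _; exact: continuous_iter. Qed.

Lemma open_visits_within f L (V : set X) :
  continuous f -> open V -> open (visits_within f L V).
Proof.
move=> cf oV.
have -> : visits_within f L V = \bigcup_(k in `I_L.+1) (iter k f @^-1` V).
  by apply/seteqP; split => x [k kL Vk]; exists k.
by apply: bigcup_open => k _; exact: open_iter_preimage.
Qed.

Lemma open_borel (U : set X) : open U -> measurable (U : set borel).
Proof. by move=> oU; apply: sub_sigma_algebra. Qed.

Lemma invariant_iter {f : X -> X} {mu : probability borel R} :
  continuous f -> invariant_measures f mu ->
  forall k (U : set X), open U -> mu (iter k f @^-1` U) = mu U.
Proof.
move=> cf inv; elim=> [//|k ih] U oU.
rewrite -(ih U oU) -(inv (iter k f @^-1` U)); last first.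
  exact: open_borel (open_iter_preimage f k U cf oU).
suff -> : iter k.+1 f @^-1` U = f @^-1` (iter k f @^-1` U) by [].
by apply/funext => x; rewrite /preimage/= -iterS iterSr.
Qed.

(** By invariance the measure of $f^{-i}$[(visits_within f L V)] does not depend
    on $i$, and it tends to the measure of the set of all points that ever visit
    [V] as [L] grows; that set contains both [W] and each of these preimages. *)
Lemma small_nonvisit {f : X -> X} {mu : probability borel R} (r : nat)
    (W V : set X) (d : R) :
  continuous f -> invariant_measures f mu -> open W -> open V ->
  W `<=` iter r f @^-1` V -> 0 < d ->
  exists L, forall L' i, (L <= L')%N ->
    (mu (W `\` iter i f @^-1` visits_within f L' V) <= d%:E)%E.
Proof.
move=> cf inv oW oV WV d0.
pose B L : set borel := visits_within f L V.
have mB L : measurable (B L).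
  exact: open_borel (open_visits_within f L V cf oV).
pose Bs : set borel := \bigcup_L B L.
have mBs : measurable Bs by exact: bigcup_measurable.
have ndB : nondecreasing_seq B.
  move=> L L' LL'; apply/subsetPset => x [k kL Vk]; exists k => //.
  exact: leq_trans LL'.
have cvB := @nondecreasing_cvg_mu _ _ _ mu _ mB mBs ndB.
have fBs : mu Bs \is a fin_num by exact: fin_num_measure.
have [L HL] : exists L, (mu Bs - d%:E <= mu (B L))%E.
  apply: contrapT => /forallNP nL.
  have : (mu Bs <= mu Bs - d%:E)%E.
    apply: (cvge_le _ cvB); apply: nearW => L /=.
    by have /negP := nL L; rewrite -ltNge => /ltW.
  by rewrite -(fineK fBs) -EFinB lee_fin; lra.
exists L => L' i LL'.
have sB : iter i f @^-1` B L' `<=` Bs.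
  move=> x [k kL]; rewrite -iterD => Vk; exists (k + i)%N => //.
  by exists (k + i)%N.
have mBi : measurable (iter i f @^-1` B L' : set borel).
  exact: open_borel (open_iter_preimage f i _ cf
                       (open_visits_within f L' V cf oV)).
apply: (@le_trans _ _ (mu (Bs `\` iter i f @^-1` B L'))).
  apply: le_measure; rewrite ?inE.
  - by apply: measurableD => //; exact: open_borel.
  - exact: measurableD.
  - by apply: setSD => x /WV Vx; exists r => //; exists r.
rewrite measureD//; last by rewrite ltey_eq fBs.
rewrite setIC (setIidl sB).
rewrite [X in (_ - X <= _)%E](invariant_iter cf inv i _
  (open_visits_within f L' V cf oV)).
have HL' : (mu Bs - d%:E <= mu (B L'))%E.
  apply: (le_trans HL); apply: le_measure; rewrite ?inE//.
  exact/subsetPset/ndB.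
move: HL'; rewrite -(fineK fBs) -(fineK (fin_num_measure mu (B L') (mB L'))).
rewrite -[X in (X - _ <= _)%E](fineK fBs) -!EFinB !lee_fin !lerBlDr.
move=> /le_trans; apply.
by rewrite addrC.
Qed.

Lemma measure_center_pos {f : X -> X} : measure_center f = [set: X] ->
  forall W : set X, open W -> W !=set0 ->
  exists2 mu : probability borel R, invariant_measures f mu & (0 < mu W)%E.
Proof.
move=> cen W oW [x Wx].
have : measure_center f x by rewrite cen.
move=> /(_ W (open_nbhs_nbhs (conj oW Wx)))[y [[mu inv mup] Wy]].
by exists mu => //; exact: mup.
Qed.

(** If every point of [W] had more than [eta * n] bad times in the window, the
    integral over [W] of the number of bad times would exceed
    [eta * n * mu W], whereas each single time is bad only on a set of measure
    [eta * mu W / 2]. The length [n] and the start [s] of the window are chosen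
    after [L]. *)
Lemma frequent_visits {f : X -> X} (r : nat) (W V : set X) (eta : R) :
  continuous f -> measure_center f = [set: X] -> open W -> W !=set0 -> open V ->
  W `<=` iter r f @^-1` V -> 0 < eta ->
  exists L, forall L' s n, (L <= L')%N -> exists2 y, W y &
    (1 - eta) * n%:R <=
    (count_below [set i | exists2 k, (k <= L')%N &
                            V (iter (i + k) f (iter s f y))] n)%:R.
Proof.
move=> cf cen oW W0 oV WV eta0.
have [mu inv muW] := measure_center_pos cen W oW W0.
have mW : measurable (W : set borel) by exact: open_borel.
have fW : mu W \is a fin_num by exact: fin_num_measure.
have m0 : 0 < fine (mu W) by rewrite fine_gt0// muW ltey_eq fW.
have d0 : 0 < eta * fine (mu W) / 2 by rewrite divr_gt0// mulr_gt0.
have [L HL] := small_nonvisit r W V _ cf inv oW oV WV d0.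
exists L => L' s n LL'.
pose D i : set borel := W `\` iter (i + s) f @^-1` visits_within f L' V.
have mD i : measurable (D i).
  apply: measurableD => //.
  exact: open_borel (open_iter_preimage f _ _ cf
                       (open_visits_within f L' V cf oV)).
have [y Wy yD] : exists2 y, W y & \sum_(i <- iota 0 n) \1_(D i) y <= eta * n%:R.
  apply: contrapT => nD.
  have {}nD y : W y -> eta * n%:R < \sum_(i <- iota 0 n) \1_(D i) y.
    by move=> Wy; rewrite ltNge; apply/negP => yD; apply: nD; exists y.
  have n0 : 0 < n%:R :> R.
    have [y Wy] := W0; have := nD y Wy; case: (n) => [|//].
    by rewrite mulr0 big_nil ltxx.
  have : ((eta * n%:R)%:E * mu W <= (n%:R * (eta * fine (mu W) / 2))%:E)%E.
    rewrite -integral_cst//.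
    apply: (@le_trans _ _
      (\int[mu]_(x in W) \sum_(i <- iota 0 n) (\1_(D i) x)%:E)%E).
      apply: ge0_le_integral => //.
      - by move=> x _; rewrite lee_fin mulr_ge0// ltW.
      - apply: emeasurable_sum => i; apply/measurable_EFinP.
        exact: measurable_indic.
      - by move=> x Wx; rewrite sumEFin lee_fin ltW// nD.
    rewrite ge0_integral_sum//; last first.
      by move=> i; apply/measurable_EFinP; exact: measurable_indic.
    apply: (@le_trans _ _ (\sum_(i <- iota 0 n) (eta * fine (mu W) / 2)%:E)%E).
      apply: lee_sum => i _; rewrite integral_indic//.
      rewrite setIidl; first exact: HL.
      by move=> x [].
    rewrite sumEFin lee_fin big_const_seq count_predT size_iota iter_addr_0.
    by rewrite mulr_natl.
  rewrite -{1}(fineK fW) -EFinM lee_fin.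
  have : 0 < eta * n%:R * fine (mu W) by rewrite !mulr_gt0.
  move: (fine _) (n%:R) => m k; clear -m k eta => pos le; lra.
exists y => //.
set G := [set i | _].
have : n%:R <= (count_below G n)%:R + \sum_(i <- iota 0 n) (\1_(D i) y : R).
  rewrite count_belowE natr_sum /index_iota subn0 -big_split/=.
  rewrite -[leLHS](_ : \sum_(i <- iota 0 n) 1 = _); last first.
    by rewrite big_const_seq count_predT size_iota iter_addr_0.
  apply: ler_sum => i _; rewrite indicE.
  case: (boolP (i \in G)) => [_|/negP iG]; first by rewrite lerDl.
  rewrite mem_set ?add0r//; split=> // -[k kL Vk]; apply: iG; apply/mem_set.
  by exists k => //; move: Vk; rewrite /= -iterD addnA [(k + i)%N]addnC iterD.
move: yD; move: (_ G n)%:R (\sum_(i <- _) _) (n%:R) => g b k.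
clear -g b k eta => *.
lra.
Qed.

End visits.

(** * Common hitting times *)

Lemma open_margin {R : realType} {X : metricType R} (V : set X) (v : X) :
  open V -> V v -> exists V0 e, [/\ open V0, V0 v, 0 < e &
    forall x y, V0 x -> mdist x y < e -> V y].
Proof.
move=> oV Vv.
have /nbhs_ballP[r /= r0 rV] := open_nbhs_nbhs (conj oV Vv).
have r20 : 0 < r / 2 by rewrite divr_gt0.
exists (ball v (r / 2))^°, (r / 2); split=> //; first exact: open_interior.
  exact: nbhsx_ballx.
move=> x y /interior_subset; rewrite ballEmdist/= => vx xy; apply: rV.
by rewrite ballEmdist/= (le_lt_trans (metric_triangle _ x _))// (splitr r) ltrD.
Qed.

Lemma hitting_timesP {T : Type} (g : T -> T) (A B : set T) (n : nat) :
  hitting_times g A B n <-> (0 < n)%N /\ exists2 x, A x & B (iter n g x).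
Proof.
split=> [[n0 [_ [[x Ax <-] Bx]]]|[n0 [x Ax Bx]]]; first by split=> //; exists x.
by split=> //; exists (iter n g x); split=> //; exists x.
Qed.

Section common_hitting.
Context {R : realType} {X : pointedMetricType R} (f : X -> X) (alpha : R).
Hypotheses (halpha : 0 < alpha < 1) (hf : dynamical_system f).
Hypothesis hcenter : measure_center f = [set: X].
Hypothesis hshadow : density_shadowing alpha f.

(** The hypothesis that every point of [W] visits [V] at the same time [r] puts
    [W] inside the set of points that ever visit [V], where frequent visits are
    available. With [W = V] and [r = 0] it holds trivially, and the conclusion
    already contains topological transitivity. *)
Lemma common_hitting_time_reachable (r : nat) (U W V : set X) :
  open U -> U !=set0 -> open W -> W !=set0 -> open V ->
  W `<=` iter r f @^-1` V ->
  exists k, hitting_times f U V k /\ hitting_times f W V k.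
Proof.
have [cX cf _] := hf; have /andP[a0 a1] := halpha.
move=> oU [u Uu] oW [w Ww] oV WV.
have [U0 [eU [oU0 U0u eU0 U0P]]] := open_margin U u oU Uu.
have [V0 [eV [oV0 V0w eV0 V0P]]] := open_margin V (iter r f w) oV (WV w Ww).
(* Shrinking the targets leaves room for the shadowing error. *)
pose W0 := W `&` iter r f @^-1` V0.
have oW0 : open W0 by apply: openI => //; exact: open_iter_preimage.
have h20 : 0 < alpha / 2 by rewrite divr_gt0.
have U0n : U0 !=set0 by exists u.
have W0n : W0 !=set0 by exists w.
have [LU HU] := frequent_visits 0 U0 U0 _ cf hcenter oU0 U0n oU0
  (fun _ h => h) h20.
have [LV HV] := frequent_visits r W0 V0 _ cf hcenter oW0 W0n oV0
  (@subIsetr _ _ _) h20.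
have [M aM] : exists M : nat, 2 < alpha * M%:R.
  exists (Num.truncn (2 / alpha)).+1.
  by rewrite mulrC -ltr_pdivrMr//; apply: truncnS_gt.
have M1 : (1 < M)%N.
  rewrite -(ltr_nat R) (@lt_trans _ _ 2) ?ltr1n// (lt_le_trans aM)//.
  by rewrite ler_piMl// ltW.
pose L := maxn LU LV.
(* The 2-adic valuation is a block type taking every value infinitely often.
   For blocks of type [a.+1] that start before time [a], truncated subtraction
   makes the segment start at [y]; only later blocks of that type are used. *)
pose T p := if logn 2 p is 0 then U0 else V0.
pose good p x := (1 - alpha / 2) * (M ^ p.+1 - M ^ p)%:R <=
  (count_below [set i | exists2 k, (k <= L)%N & T p (iter (i + k) f x)]
     (M ^ p.+1 - M ^ p))%:R.
have /choice[x xP] : forall p, exists x, good p x /\ forall a,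
    logn 2 p = a.+1 -> exists2 y, W0 y & x = iter (M ^ p - a) f y.
  move=> p; rewrite /good /T; case: (logn 2 p) => [|a].
    have [y _ Hy] := HU L 0%N (M ^ p.+1 - M ^ p)%N (leq_maxl _ _).
    by exists y; split.
  have [y W0y Hy] := HV L (M ^ p - a)%N (M ^ p.+1 - M ^ p)%N (leq_maxr _ _).
  by exists (iter (M ^ p - a) f y); split=> // b [<-]; exists y.
pose e := Num.min eU eV.
have e0 : 0 < e by rewrite lt_min eU0.
have [z [p0 zP]] := shadow_blocks f alpha e L M T x cX cf hshadow halpha e0 aM
  (fun p => (xP p).1).
have type_cofinal a N : exists2 p, (N <= p)%N & logn 2 p = a.
  exists (2 ^ a * N.*2.+1)%N.
    by rewrite (@leq_trans N.*2.+1)// ?leq_pmull ?expn_gt0//; lia.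
  rewrite lognM ?expn_gt0// pfactorK// lognE/= dvdn2/= odd_double/= addn0//.
have [p p0p lp] := type_cofinal 0%N p0.
have [m [Tm dm]] := zP p p0p.
rewrite /T lp in Tm.
set a := (M ^ p + m)%N in dm.
have Uz : U (iter a f z).
  by apply: U0P Tm _; rewrite (lt_le_trans dm)// ge_min lexx.
have [q q0q lq] := type_cofinal a.+1 (maxn p0 a).
have [m' [Tm' dm']] := zP q (leq_trans (leq_maxl _ _) q0q).
rewrite /T lq in Tm'.
have Vz : V (iter (M ^ q + m') f z).
  by apply: V0P Tm' _; rewrite (lt_le_trans dm')// ge_min lexx orbT.
have [y [Wy _] xy] := (xP q).2 a lq.
have aMq : (a < M ^ q)%N.
  exact: leq_ltn_trans (leq_trans (leq_maxr _ _) q0q) (ltn_expl _ M1).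
exists (M ^ q - a + m')%N; split; split.
- by rewrite addn_gt0 subn_gt0 aMq.
- exists (iter (M ^ q + m') f z); split=> //.
  exists (iter a f z) => //; rewrite -iterD; congr iter.
  by rewrite addnAC subnK // ltnW.
- by rewrite addn_gt0 subn_gt0 aMq.
- exists (iter m' f (x q)); split.
    by exists y => //; rewrite xy -iterD addnC.
  by apply: (V0P _ _ Tm'); rewrite mdistxx.
Qed.

Lemma common_hitting_time (U W V : set X) :
  open U -> U !=set0 -> open W -> W !=set0 -> open V -> V !=set0 ->
  exists k, hitting_times f U V k /\ hitting_times f W V k.
Proof.
move=> oU U0 oW W0 oV V0; have [_ cf _] := hf.
(* Some points of [W] visit [V] at a common time [r]; shrink [W] to them. *)
have [r [/hitting_timesP[_ [w Ww Vw]] _]] :=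
  common_hitting_time_reachable 0 W V V oW W0 oV V0 oV (fun _ h => h).
have [||k [kU /hitting_timesP[k0 [x [Wx _] Vx]]]] :=
  common_hitting_time_reachable r U (W `&` iter r f @^-1` V) V oU U0 _ _ oV
    (@subIsetr _ _ _).
- by apply: openI => //; exact: open_iter_preimage.
- by exists w.
by exists k; split=> //; apply/hitting_timesP; split=> //; exists x.
Qed.

End common_hitting.

(** * Weak mixing *)

Lemma iter_prod_map {T : Type} (f : T -> T) n (p : T * T) :
  iter n (prod_map f) p = (iter n f p.1, iter n f p.2).
Proof. by elim: n => [|n ih]; [case: p|rewrite iterS ih]. Qed.

Lemma open_rectangle {S T : topologicalType} (O : set (S * T)) :
  open O -> O !=set0 -> exists A B, [/\ open A, A !=set0, open B, B !=set0 &
    A `*` B `<=` O].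
Proof.
move=> oO [[x y] Oxy].
have [[A B] /= [Ax By] ABO] : nbhs (x, y) O by apply: open_nbhs_nbhs.
exists A^°, B^°; split; [exact: open_interior|by exists x
                        |exact: open_interior|by exists y|].
by move=> [a b] [/= /interior_subset Aa /interior_subset Bb]; apply: ABO.
Qed.

Theorem corollary4p1 (R : realType) (X : pointedMetricType R) (f : X -> X)
    (alpha : R) (halpha : 0 < alpha < 1)
    (hf : dynamical_system f)
    (hcenter : measure_center f = [set: X])
    (hshadow : density_shadowing alpha f) :
  weakly_mixing f.
Proof.
move=> U V oU oV U0 V0; have [_ cf sf] := hf.
have [U1 [U2 [oU1 U10 oU2 [u2 U2u2] UP]]] := open_rectangle U oU U0.
have [V1 [V2 [oV1 V10 oV2 V20 VP]]] := open_rectangle V oV V0.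
have hit := common_hitting_time f alpha halpha hf hcenter hshadow.
have [n [/hitting_timesP[_ [v V1v V2v]] _]] :=
  hit V1 V1 V2 oV1 V10 oV1 V10 oV2 V20.
have surj_iter m : exists y, iter m f y = u2.
  elim: m => [|m [y <-]]; first by exists u2.
  by have [x _ <-] := sf y I; exists x; rewrite iterSr.
have [u2' u2'E] := surj_iter n.
have [||||k [/hitting_timesP[k0 [u U1u [V1u _]]]
             /hitting_timesP[_ [u' U2u' [_ V2u']]]]]
  := hit U1 (iter n f @^-1` U2) (V1 `&` iter n f @^-1` V2) oU1 U10.
- exact: open_iter_preimage.
- by exists u2'; rewrite /preimage/= u2'E.
- by apply: openI => //; exact: open_iter_preimage.
- by exists v.
exists k; apply/hitting_timesP; split=> //.
exists (u, iter n f u'); first exact: UP.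
rewrite iter_prod_map; apply: VP; split=> //=.
by move: V2u'; rewrite /preimage/= -!iterD addnC.
Qed.
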